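(* For any symmetric probability measure $\mu$ on $\mathbb{R}$, $$\Gamma^*(\mu|\mathrm{b})\le\frac12\Psi^*(\mu|\mathrm{b}).$$
   Context: $\mathrm{b}=\frac12\delta_{-1}+\frac12\delta_{1}$ is the Rademacher distribution. For a symmetric probability measure $\mu$ on $\mathbb{R}$, the Non-microstates Boolean entropy and Fisher information relative to $\mathrm{b}$ are $$\Gamma^*(\mu|\mathrm{b})=\frac12\int x^2\,d\mu(x)+\frac12\log\int\frac1{x^2}\,d\mu(x)-\frac12\in[0,+\infty],$$ $$\Psi^*(\mu|\mathrm{b})=\int\frac1{x^2}\,d\mu(x)+\int x^2\,d\mu(x)-2\in[0,+\infty],$$ with $1/0=+\infty$ and $\log(+\infty)=+\infty$. *)

(* Defs.v *)
From HB Require Import structures.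
From mathcomp Require Import all_boot all_order all_algebra.
From mathcomp Require Import all_classical all_reals all_analysis.

Set Implicit Arguments.
Unset Strict Implicit.
Unset Printing Implicit Defensive.

Import Order.TTheory GRing.Theory Num.Theory.

Local Open Scope classical_set_scope.
Local Open Scope ring_scope.
Local Open Scope ereal_scope.

Definition symmetric_measure (R : realType)
    (mu : probability (measurableTypeR R) R) : Prop :=
  forall A : set (measurableTypeR R), measurable A ->
    pushforward mu (-%R : measurableTypeR R -> measurableTypeR R) A = mu A.

Definition second_moment (R : realType)
    (mu : probability (measurableTypeR R) R) : \bar R :=
  \int[mu]_x (x ^+ 2)%:E.

(* The inverse is the one of the extended reals, for which 0^-1 = +oo; the
   inverse of the field R would give 0 at x = 0. *)
Definition inverse_second_moment (R : realType)
    (mu : probability (measurableTypeR R) R) : \bar R :=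
  \int[mu]_x ((x ^+ 2)%:E)^-1.

(* Non-microstates Boolean entropy relative to the Rademacher distribution
   b = (delta_{-1} + delta_1) / 2. The logarithm lne satisfies lne +oo = +oo;
   its value -oo at 0 plays no role, as inverse_second_moment mu > 0. *)
Definition boolean_entropy_rademacher (R : realType)
    (mu : probability (measurableTypeR R) R) : \bar R :=
  (2^-1)%:E * second_moment mu
  + (2^-1)%:E * lne (inverse_second_moment mu) - (2^-1)%:E.

(* Non-microstates Boolean Fisher information relative to b. *)
Definition boolean_fisher_rademacher (R : realType)
    (mu : probability (measurableTypeR R) R) : \bar R :=
  inverse_second_moment mu + second_moment mu - 2%:E.

(* Main.v *)
Require Import Defs.
From mathcomp Require Import all_boot all_order all_algebra.
From mathcomp Require Import all_classical all_reals all_analysis.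
From mathcomp Require Import lra.

Import Order.TTheory GRing.Theory Num.Theory.

(** Put m for the integral of x^2 and i for that of 1/x^2. When both are finite and i > 0, m/2
    cancels and the claim is the tangent-line bound log i <= i - 1. [half_lne_le] settles it for all
    m, i in [0, +oo], so nonnegativity of the two integrals suffices. *)

Lemma half_lne_le (R : realType) (m i : \bar R) :
  (0 <= m)%E -> (0 <= i)%E ->
  ((2^-1)%:E * m + (2^-1)%:E * lne i - (2^-1)%:E <=
   (2^-1)%:E * (i + m - 2%:E))%E.
Proof.
have h0 : (0 < (2^-1)%:E :> \bar R)%E by rewrite lte_fin invr_gt0.
have mul_half_y : ((2^-1)%:E * +oo = +oo :> \bar R)%E by rewrite gt0_muley.
case: i => [i| |] //; case: m => [m| |] // m0; last 3 first.
(* If [m] or [i] is infinite, [i + m - 2%:E] computes to [+oo], so [mul_half_y] matches up to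
   conversion. *)
- by move=> _; rewrite [leRHS]mul_half_y leey.
- by move=> _; rewrite [leRHS]mul_half_y leey.
- by move=> _; rewrite [leRHS]mul_half_y leey.
rewrite lee_fin le_eqVlt => /predU1P[<-|i0].
  (* At [i = 0], [lne] takes the value [-oo], which makes the left side [-oo]. *)
  by rewrite le0_lneNy // gt0_muleNy // addeNy addNye leNye.
rewrite lne_EFin // -!(EFinN, EFinM, EFinD) lee_fin.
have : (ln i <= i - 1)%R.
  by rewrite -{1}(subrKC 1%R i) le_ln1Dx // ltrBrDr addNr.
lra.
Qed.

Theorem theorem2p14 (R : realType) (mu : probability (measurableTypeR R) R)
    (mu_sym : symmetric_measure mu) :
  (boolean_entropy_rademacher mu <=
   (2^-1)%:E * boolean_fisher_rademacher mu)%E.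
Proof.
apply: half_lne_le; apply: integral_ge0 => x _.
- by rewrite lee_fin sqr_ge0.
- by rewrite inve_ge0 lee_fin sqr_ge0.
Qed.
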